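(* Let each $f_i:\mathcal H\to\mathbb R$ be convex and continuously differentiable, with gradient $\nabla f_i$ Lipschitz with constant $L_i$, where $L_i\le\sup L<\infty$ almost surely for $i\sim\mathcal D$, and let $F(x)=\mathbb E_{i\sim\mathcal D} f_i(x)$ be $\mu$-strongly convex, $\mu>0$. Set $\sigma^2=\mathbb E_{i\sim\mathcal D}\|\nabla f_i(x_\star)\|_2^2$, where $x_\star=\arg\min_x F(x)$, and let $\varepsilon_0=\|x_0-x_\star\|_2^2$ for a starting point $x_0\in\mathcal H$. For any desired $\varepsilon>0$, consider the stochastic gradient descent iterates $x_{k+1}=x_k-\gamma\nabla f_{i_k}(x_k)$, with $i_0,i_1,\dots$ drawn i.i.d. from $\mathcal D$, with step size $$\gamma=\frac{\mu\varepsilon}{2\varepsilon\mu\sup L+2\sigma^2}.$$ Then $\mathbb E\|x_k-x_\star\|_2^2\le\varepsilon$ for every integer $k\ge 0$ with $$k\ge 2\log(2\varepsilon_0/\varepsilon)\Bigl(\frac{\sup L}{\mu}+\frac{\sigma^2}{\mu^2\varepsilon}\Bigr),$$ where the expectation is with respect to the sampling of $\{i_k\}$ (if $\varepsilon_0=0$, the condition on $k$ is regarded as satisfied by every $k\ge0$).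
   Context: $\mathcal H$ is $\mathbb R^d$ with the Euclidean norm $\|\cdot\|_2$, or a Hilbert space with norm $\|\cdot\|_2$. $\mathcal D$ is a probability distribution (the source distribution) on an arbitrary probability space of indices $i$. Lipschitz gradient with constant $L_i$ means $\|\nabla f_i(x)-\nabla f_i(y)\|_2\le L_i\|x-y\|_2$ for all $x,y$. $F$ is $\mu$-strongly convex means $\langle x-y,\nabla F(x)-\nabla F(y)\rangle\ge\mu\|x-y\|_2^2$ for all $x,y$. $\sup L$ denotes the smallest $L$ such that $L_i\le L$ almost surely. The gradient estimates are unbiased: $\mathbb E_{i\sim\mathcal D}\nabla f_i(x)=\nabla F(x)$ for all $x$, and $\sigma^2<\infty$. $\log$ is the natural logarithm. *)

(* Defs.v *)
From HB Require Import structures.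
From mathcomp Require Import all_boot all_order all_algebra.
From mathcomp Require Import finmap sesquilinear.
From mathcomp Require Import all_classical all_reals all_analysis.

Set Implicit Arguments.
Unset Strict Implicit.
Unset Printing Implicit Defensive.
Import Order.TTheory GRing.Theory Num.Theory.
Import numFieldNormedType.Exports.

Local Open Scope classical_set_scope.
Local Open Scope ring_scope.

(* A real Hilbert space is rendered as a complete normed space [H] over
   [R : realType] with a positive definite symmetric bilinear form
   [ip : {dot H for idfun}] such that [norm_induced_by ip] holds.  Euclidean
   R^d is the finite-dimensional case; it is not the library's ['rV[R]_d],
   whose norm is the maximum norm. *)
Definition norm_induced_by (R : realType) (H : normedModType R)
    (ip : {dot H for idfun}) : Prop :=
  forall x : H, `|x| ^+ 2 = ip x x.

(* [f] is Frechet differentiable at [x] and its differential is represented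
   by the vector [g]. *)
Definition is_gradient (R : realType) (H : normedModType R)
    (ip : {dot H for idfun}) (f : H -> R) (x g : H) : Prop :=
  is_diff x (f : H -> R^o) (fun v => ip g v : R^o).

Definition strongly_convex (R : realType) (H : normedModType R)
    (ip : {dot H for idfun}) (mu : R) (gradF : H -> H) : Prop :=
  forall x y : H, mu * `|x - y| ^+ 2 <= ip (x - y) (gradF x - gradF y).

Section bochner.
Context d (T : measurableType d) (R : realType) (P : probability T R)
  (E : normedModType R).

(* The library's [{sfun T >-> R}] only covers real-valued simple functions. *)
Definition is_simple (s : T -> E) : Prop :=
  finite_set (range s) /\ forall y : E, measurable (s @^-1` [set y]).

Definition simple_expectation (s : T -> E) : E :=
  \sum_(y \in range s) fine (P (s @^-1` [set y])) *: y.

(* [X] is Bochner integrable with expectation [m].  In particular [X] is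
   strongly measurable, i.e. a pointwise limit of simple functions; for
   separable [E] this is the same as Borel measurability. *)
Definition has_expectation (X : T -> E) (m : E) : Prop :=
  exists s : nat -> T -> E,
    [/\ forall n, is_simple (s n),
        forall w, s n w @[n --> \oo] --> X w,
        (\int[P]_w (`|X w - s n w|)%:E)%E @[n --> \oo] --> 0%E &
        simple_expectation (s n) @[n --> \oo] --> m].

End bochner.

Section iid.
Context d (T : measurableType d) d' (I : measurableType d') (R : realType)
  (P : probability T R) (D : probability I R).

Definition mutually_independent (xi : nat -> {RV P >-> I}) : Prop :=
  forall (J : {fset nat}) (A : nat -> set I), (forall k, measurable (A k)) ->
    P (\bigcap_(k in [set` J]) (xi k @^-1` A k))
    = (\prod_(k <- J) P (xi k @^-1` A k))%E.

Definition iid (xi : nat -> {RV P >-> I}) : Prop :=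
  (forall k (A : set I), measurable A -> distribution P (xi k) A = D A)
  /\ mutually_independent xi.

End iid.

Fixpoint sgd (R : realType) (H : lmodType R) (I : Type) (gradf : I -> H -> H)
    (gamma : R) (x0 : H) (i : nat -> I) (k : nat) : H :=
  if k is k'.+1 then
    sgd gradf gamma x0 i k' - gamma *: gradf (i k') (sgd gradf gamma x0 i k')
  else x0.

(* Main.v *)
Require Import Defs.
From HB Require Import structures.
From mathcomp Require Import all_boot all_order all_algebra.
From mathcomp Require Import finmap sesquilinear.
From mathcomp Require Import all_classical all_reals all_analysis ess_sup_inf.
From mathcomp Require Import measurable_realfun ring lra.

Set Implicit Arguments.
Unset Strict Implicit.
Unset Printing Implicit Defensive.
Import Order.TTheory GRing.Theory Num.Theory.
Import numFieldNormedType.Exports.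

Local Open Scope classical_set_scope.
Local Open Scope ring_scope.

(** Write [q] for the one-step factor
    [1 - 2 * gamma * mu * (1 - gamma * supL)].

    For a fixed point [y] and one random index [i], the squared distance of
    [y - gamma *: gradf i y] to [xstar] has expectation at most
    [q * `|y - xstar| ^+ 2 + 2 * gamma ^+ 2 * sigma2] ([sgd_step_le]). The
    second moment of [gradf i y] is what has to be controlled; almost every
    [f i] is convex with a [supL]-Lipschitz gradient, so its gradient is
    co-coercive ([cocoercive]), and the excess of the second moment over
    [2 * sigma2] is paid by the descent term as long as [gamma * supL <= 1].
    With the chosen [gamma] the noise is at most [(1 - q) * (eps / 2)]
    ([contraction_noise_le]), so the squared distance to [xstar] is dominated,
    in expectation, by the affine recursion with rate [q] and fixed point
    [eps / 2]. The condition on [k] says that the initial error has been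
    multiplied by at most [expR (- ln (2 * eps0 / eps))]
    ([contraction_rate_exp_le]), that is, brought below [eps / 2] as well.

    Iterating the one-step bound requires that the draw [xi k] be independent
    of the current point, and that the expectation over [xi k] can be taken
    with this point frozen. Conditional expectations, product measures and
    joint measurability are avoided by running the induction backwards
    ([integral_iterate_le]): the claim for [m] steps from a deterministic
    point is proved on all events that constrain the earlier draws one by one.
    The first step is approximated by simple functions of its draw, whose
    level sets are again such events, so that independence enters only through
    the product formula, and Fatou's lemma passes to the limit because the
    iterates depend continuously on the starting point. The approximants come
    from the Bochner integrability of the gradients, truncated so that their
    second moments converge ([sgd_step_approx]). *)

(** * Gradients of smooth convex functions on a Hilbert space *)

Section inner_product.
Context (R : realType) (H : normedModType R) (ip : {dot H for idfun}).
Hypothesis Hilbert : norm_induced_by ip.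
Implicit Types (x y z v : H) (t : R).

Lemma ipC x y : ip x y = ip y x.
Proof. by rewrite hermC expr0 mul1r. Qed.

Lemma ipDr x y z : ip x (y + z) = ip x y + ip x z.
Proof. exact: linearDr. Qed.

Lemma ipZr t x y : ip x (t *: y) = t * ip x y.
Proof. exact: linearZr. Qed.

Lemma ipNr x y : ip x (- y) = - ip x y.
Proof. exact: linearNr. Qed.

Lemma ipDl x y z : ip (x + y) z = ip x z + ip y z.
Proof. by rewrite ipC ipDr !(ipC z). Qed.

Lemma ipZl t x y : ip (t *: x) y = t * ip x y.
Proof. by rewrite ipC ipZr ipC. Qed.

Lemma ipNl x y : ip (- x) y = - ip x y.
Proof. by rewrite ipC ipNr ipC. Qed.

Definition ipE := (ipDr, ipDl, ipNr, ipNl, ipZr, ipZl).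

Lemma sqr_normB x y : `|x - y| ^+ 2 = `|x| ^+ 2 - 2 * ip x y + `|y| ^+ 2.
Proof. rewrite !Hilbert !ipE (ipC y x); ring. Qed.

(** The triangle inequality is part of the normed space structure, and
    squaring it gives the bound on one side. *)
Lemma cauchy_schwarz x y : `|ip x y| <= `|x| * `|y|.
Proof.
have le_ip u v : ip u v <= `|u| * `|v|.
  have : `|u + v| ^+ 2 <= (`|u| + `|v|) ^+ 2.
    by rewrite ler_sqr ?nnegrE ?addr_ge0// ler_normD.
  by rewrite Hilbert !ipE (ipC v u) sqrrD -!Hilbert; lra.
by rewrite ler_norml lerNl -ipNr (le_trans (le_ip _ _)) ?normrN ?le_ip.
Qed.

(** Reduces every statement on gradients below to one real variable. *)
Lemma is_gradient_line (f : H -> R) (g : H -> H) x v t :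
  (forall u, is_gradient ip f u (g u)) ->
  is_derive t 1 (fun s : R => f (x + s *: v) : R^o) (ip (g (x + t *: v)) v).
Proof.
move=> fg.
have dl : is_diff (t : R^o) (fun s : R^o => x + s *: v) (fun s : R^o => s *: v).
  have -> : (fun s : R^o => x + s *: v) = cst x + ( *:%R^~ v) by [].
  apply: is_diff_eq; rewrite add0r; apply/funext => s //=.
have /= dc := is_diff_comp dl (fg (x + t *: v)).
have -> : (fun s : R => f (x + s *: v) : R^o) =
    (f : H -> R^o) \o (fun s : R^o => x + s *: v) by [].
apply: DeriveDef.
  exact/diff_derivable/ex_diff.
rewrite deriveE; last exact/ex_diff.
by rewrite diff_val /= scale1r.
Qed.

(** First-order principle: a function that stays above a chord issued from the
    origin has a slope at the origin not below that of the chord. Convexity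
    and minimality are both used through it. *)
Lemma is_derive_ge (h : R -> R) d c :
  is_derive (0 : R) 1 (h : R -> R^o) d ->
  (forall t, 0 < t <= 1 -> h 0 + t * c <= h t) -> c <= d.
Proof.
move=> [hd <-] hc; rewrite /derive cvg_at_rightE; last exact: hd.
apply: limr_ge; first exact/cvgP/cvg_dnbhs_at_right/hd.
near=> t.
have t0 : 0 < t by [].
rewrite /= [X in X + 0]mulr1 addr0 [leRHS]/(_ *: _) ler_pdivlMl//.
rewrite lerBrDl hc// t0 /=.
by near: t; apply: nbhs_right_le.
Unshelve. all: by end_near. Qed.

(** On the segment from [x] to [y] convexity puts [f] below the chord, so the
    slope of [f] at [x] is at most [f y - f x]. *)
Lemma convex_ge_tangent (f : H -> R) (g : H -> H) x y :
  convex_function [set: H] f -> (forall u, is_gradient ip f u (g u)) ->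
  f x + ip (g x) (y - x) <= f y.
Proof.
move=> fc fg.
suff : ip (g x) (y - x) <= f y - f x by lra.
rewrite -lerN2; apply: (is_derive_ge (h := fun t => - f (x + t *: (y - x)))).
  have := is_gradient_line x (y - x) 0 fg; rewrite scale0r addr0.
  exact: is_deriveN.
move=> t /andP[t0 t1].
rewrite scale0r addr0.
have := fc (Itv01 (ltW t0) t1) y x (mem_set Logic.I) (mem_set Logic.I).
rewrite convR_line_path /line_path /=.
have -> : conv (Itv01 (ltW t0) t1) (y : convex_lmodType H) x = x + t *: (y - x).
  rewrite -[LHS]/(t *: y + (1 - t) *: x).
  by rewrite scalerBl scale1r scalerBr addrCA.
by lra.
Qed.

(** Otherwise [f] would decrease in the direction [- g x]. *)
Lemma gradient_min_eq0 (f : H -> R) (g : H -> H) x :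
  (forall u, is_gradient ip f u (g u)) -> (forall y, f x <= f y) -> g x = 0.
Proof.
move=> fg fmin; apply/eqP; rewrite -normr_eq0 -sqrf_eq0 eq_le sqr_ge0 andbT.
rewrite Hilbert -oppr_ge0 -ipNr.
apply: (is_derive_ge (h := fun t => f (x + t *: (- g x)))).
  by have := is_gradient_line x (- g x) 0 fg; rewrite scale0r addr0.
by move=> t _; rewrite scale0r addr0 mulr0 addr0 fmin.
Qed.

(** Descent lemma: along the segment the slope of [f] exceeds its initial
    value by at most [L * `|y - x| ^+ 2 * t], so subtracting the quadratic
    majorant leaves a nonincreasing function of [t]. *)
Lemma lipschitz_gradient_le (f : H -> R) (g : H -> H) (L : R) x y :
  (forall u, is_gradient ip f u (g u)) ->
  (forall u v, `|g u - g v| <= L * `|u - v|) ->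
  f y <= f x + ip (g x) (y - x) + L / 2 * `|y - x| ^+ 2.
Proof.
move=> fg gL; set v := y - x; pose h (t : R) : R :=
  f (x + t *: v) - t * ip (g x) v - L / 2 * `|v| ^+ 2 * t ^+ 2.
have hd (t : R) : is_derive t 1 (h : R -> R^o)
    (ip (g (x + t *: v)) v - ip (g x) v - L * `|v| ^+ 2 * t).
  have h1 := is_gradient_line x v t fg.
  apply: is_derive_eq.
  by rewrite /GRing.scale/=; field.
suff : h 1 <= h 0.
  by rewrite /h scale1r scale0r addr0 /v (addrC x) subrK; lra.
apply: (@ler0_derive1_nincr _ h 0 1) => //.
- move=> t /[!in_itv]/= /andP[t0 _].
  rewrite derive1E derive_val.
  have : ip (g (x + t *: v) - g x) v <= L * `|v| ^+ 2 * t.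
    apply: le_trans (ler_norm _) _; apply: le_trans (cauchy_schwarz _ _) _.
    apply: le_trans (ler_wpM2r (normr_ge0 _) (gL _ _)) _.
    by rewrite addrAC subrr add0r normrZ gtr0_norm//; lra.
  by rewrite !ipE; lra.
- apply: derivable_within_continuous => t _; by have [] := hd t.
Qed.

(** Baillon-Haddad inequality. The tangent at one point and the descent lemma
    at the other are compared at a gradient step [u - L^-1 *: (g u - g v)],
    the minimiser of the difference of the two bounds; the result is summed
    with the one where the two points are exchanged. *)
Lemma cocoercive (f : H -> R) (g : H -> H) (L : R) x y : 0 < L ->
  convex_function [set: H] f ->
  (forall u, is_gradient ip f u (g u)) ->
  (forall u v, `|g u - g v| <= L * `|u - v|) ->
  `|g x - g y| ^+ 2 <= L * ip (x - y) (g x - g y).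
Proof.
move=> L0 fc fg gL.
have half u v : f v - f u + (2 * L)^-1 * `|g u - g v| ^+ 2 <= ip (g v) (v - u).
  have [w wE] : exists w, w = g u - g v by eexists.
  have h1 := convex_ge_tangent v (u - L^-1 *: w) fc fg.
  have h2 := lipschitz_gradient_le u (u - L^-1 *: w) fg gL.
  have := le_trans h1 h2.
  rewrite (addrC u) addrK normrN normrZ gtr0_norm ?invr_gt0// -wE !ipE.
  have -> : L / 2 * (L^-1 * `|w|) ^+ 2 = (2 * L)^-1 * `|w| ^+ 2 by field; lra.
  have -> : ip (g u) w = ip (g v) w + `|w| ^+ 2.
    by rewrite Hilbert {3}wE !ipE; ring.
  have -> : L^-1 = 2 * (2 * L)^-1 by field; lra.
  lra.
have hxy := half x y; have := half y x; rewrite distrC.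
have -> : ip (g x) (x - y) = ip (x - y) (g x - g y) - ip (g y) (y - x).
  by rewrite !(ipDr, ipDl, ipNr, ipNl) !(ipC (g _)); ring.
move: hxy; set a := `|_| ^+ 2; set b := ip _ _; set b' := ip _ _.
move=> hxy hyx.
suff : L^-1 * a <= b' by rewrite ler_pdivrMl.
have -> : L^-1 = 2 * (2 * L)^-1 by field; lra.
lra.
Qed.
End inner_product.

(** * Simple and strongly measurable functions *)

Section simple_functions.
Context d (T : measurableType d) (R : realType) (E : normedModType R).
Implicit Types (s : T -> E) (Z : E -> T -> \bar R).

Lemma fsum_levels s Z (A : set E) w : finite_set A -> A (s w) ->
  (\sum_(y \in A) (Z y \_ (s @^-1` [set y])) w = Z (s w) w)%E.
Proof.
move=> finA Asw; rewrite -(@fsbig_widen _ _ _ _ [set s w]) ?fsbig_set1.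
- by rewrite patchT// inE.
- by move=> _ ->.
- by move=> y [_ /= ys]; rewrite patchN// notin_setE /= => /esym.
Qed.

Lemma measurable_simple_arg s Z : is_simple s ->
  (forall y, measurable_fun setT (Z y)) ->
  measurable_fun setT (fun w => Z (s w) w).
Proof.
move=> [fs ms] mZ.
rewrite (_ : (fun w => _) =
    (fun w => \sum_(y \in range s) (Z y \_ (s @^-1` [set y])) w)%E).
  apply: emeasurable_fsum => // y.
  by apply/(measurable_restrictT _ (ms y)) => //; exact: measurable_funTS.
by apply/funext => w; rewrite fsum_levels//; exists w.
Qed.

(** A random parameter [s] with finitely many values is frozen on each of its
    level sets; this is what replaces a disintegration or Fubini argument. *)
Lemma integral_simple_arg (mu : {measure set T -> \bar R}) s Z (B : set T) :
  is_simple s -> measurable B ->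
  (forall y, measurable_fun setT (Z y)) -> (forall y w, 0 <= Z y w)%E ->
  (\int[mu]_(w in B) Z (s w) w =
   \sum_(y \in range s) \int[mu]_(w in B `&` s @^-1` [set y]) Z y w)%E.
Proof.
move=> [fs ms] mB mZ Z0.
under eq_integral => w wB.
  rewrite -(@fsum_levels s _ (range s))//.
over.
rewrite ge0_integral_fsum//.
- by apply: eq_fsbigr => y _; rewrite integral_mkcondr.
- move=> y; apply/measurable_funTS.
  by apply/(measurable_restrictT _ (ms y)) => //; exact: measurable_funTS.
- by move=> y w _; rewrite patchE; case: ifP.
Qed.

Lemma is_simple_map (E' : normedModType R) s (h : E -> E') :
  is_simple s -> is_simple (h \o s).
Proof.
move=> [fs ms]; split.
  rewrite -(image_comp s h); exact: finite_image.
move=> z; rewrite (_ : _ @^-1` _ =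
  \bigcup_(y in range s `&` (h @^-1` [set z])) (s @^-1` [set y])).
  by apply: fin_bigcup_measurable => //; exact: finite_setIl.
apply/seteqP; split => [w /= hw|w [y [_ /= hy]] /= wy].
  by exists (s w) => //; split => //; exists w.
by rewrite wy.
Qed.

Lemma is_simple_comp d' (T' : measurableType d') (X : T' -> T) s :
  measurable_fun setT X -> is_simple s -> is_simple (s \o X).
Proof.
move=> mX [fs ms]; split.
  by apply: sub_finite_set fs => _ [w _ <-]; exists (X w).
by move=> z; rewrite -[_ @^-1` _]setTI; apply: (mX measurableT _ (ms z)).
Qed.

Lemma is_simple_patch0 s (A : set T) :
  measurable A -> is_simple s -> is_simple (patch (fun=> 0) A s).
Proof.
move=> mA [fs ms]; split.
  apply: (@sub_finite_set _ _ (range s `|` [set 0])).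
    move=> _ [w _ <-]; rewrite /patch.
    by case: ifP => _; [left; exists w|right].
  by rewrite finite_setU.
move=> z; have [->|z0] := eqVneq z 0.
  rewrite (_ : _ @^-1` _ = ~` (A `\` s @^-1` [set 0])).
    by apply: measurableC; exact: measurableD.
  apply/seteqP; split => w /=; rewrite /patch.
    by case: ifPn => [|/negP]; rewrite inE => wA sw [].
  case: ifPn => //; rewrite inE => wA /not_andP[]// /contrapT.
  by [].
rewrite (_ : _ @^-1` _ = A `&` s @^-1` [set z]); first exact: measurableI.
apply/seteqP; split => w /=; rewrite /patch.
  by case: ifPn => [|_ z0']; [rewrite inE|rewrite -z0' eqxx in z0].
by move=> [wA <-]; rewrite mem_set.
Qed.

Lemma measurable_fun_simple d' (Y : measurableType d') (h : E -> Y) s :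
  is_simple s -> measurable_fun setT (h \o s).
Proof.
move=> [fs ms] _ C mC; rewrite setTI (_ : _ @^-1` _ =
  \bigcup_(y in range s `&` (h @^-1` C)) (s @^-1` [set y])).
  by apply: fin_bigcup_measurable => //; exact: finite_setIl.
apply/seteqP; split => [w /= hw|w [y [_ /= hy]] /= wy].
  by exists (s w) => //; split => //; exists w.
by rewrite /= wy.
Qed.

(** The pointwise part of Bochner integrability: it makes sense of
    measurability for functions into a space that need not be separable. *)
Definition strong_limit (s : nat -> T -> E) (X : T -> E) : Prop :=
  (forall n, is_simple (s n)) /\ (forall w, s n w @[n --> \oo] --> X w).

Lemma measurable_strong_limit (s : nat -> T -> E) X (h : E -> R) :
  continuous h -> strong_limit s X -> measurable_fun setT (h \o X).
Proof.
move=> ch [ss sX].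
apply: (@measurable_fun_cvg _ _ _ _ (fun n => h \o s n)).
  by move=> n; exact: measurable_fun_simple.
by move=> w _; apply: continuous_cvg; [exact: ch|exact: sX].
Qed.

(** The approximants are set to [0] where their norm exceeds [`|X w| + 1]; at
    a given [w] this happens finitely often, so the limit is unchanged. *)
Lemma strong_limit_dominated (s : nat -> T -> E) X : strong_limit s X ->
  exists s' : nat -> T -> E, strong_limit s' X /\
    forall n w, `|s' n w| <= `|X w| + 1.
Proof.
move=> sX; have [ss sl] := sX.
have mX : measurable_fun setT (fun w => `|X w|).
  exact: (measurable_strong_limit (@norm_continuous _ _)) sX.
pose A n := [set w | `|s n w| <= `|X w| + 1].
exists (fun n => patch (fun=> 0) (A n) (s n)); split; [split|].
- move=> n; apply: is_simple_patch0 => //.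
  rewrite -[A n]setTI.
  apply: (measurable_fun_le _ _) => //.
  + exact: (measurable_fun_simple (@Num.norm _ E)).
  + exact: measurable_funD.
- move=> w; apply: cvg_trans (sl w); apply: near_eq_cvg.
  have sw : `|s n w| @[n --> \oo] --> `|X w| by exact: cvg_norm.
  have wlt : `|X w| < `|X w| + 1 by rewrite ltrDl.
  apply: filterS (cvgr_le _ sw _ wlt) => n sn.
  by rewrite patchT// inE.
- move=> n w; rewrite /patch; case: ifPn; first by rewrite inE.
  by rewrite normr0 addr_ge0.
Qed.

End simple_functions.

(** * Independence of the past *)

Section past_events.
Context d (T : measurableType d) d' (I : measurableType d') (R : realType)
  (P : probability T R) (D : probability I R) (xi : nat -> {RV P >-> I}).
Hypothesis xi_iid : iid D xi.
Implicit Types (A : nat -> set I) (C : set I).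

(** Rectangles in the first [j] coordinates. They are the only events of the
    past for which independence from the next draw is needed, and on them it
    is the product formula itself. *)
Definition past_event A j : set T :=
  [set w | forall l, (l < j)%N -> A l (xi l w)].

Lemma past_eventS A j : past_event A j.+1 = past_event A j `&` xi j @^-1` A j.
Proof.
apply/seteqP; split => [w Aw|w [Aw Awj] l].
  by split=> [l lj|]; apply: Aw => //; exact: ltnW.
by rewrite ltnS leq_eqVlt => /predU1P[->|/Aw].
Qed.

Lemma measurable_past_event A j : (forall l, measurable (A l)) ->
  measurable (past_event A j).
Proof.
move=> mA; elim: j => [|j IH].
  by rewrite (_ : past_event A 0 = setT)//; apply/seteqP; split.
rewrite past_eventS; apply: measurableI => //.
by rewrite -[_ @^-1` _]setTI; exact: measurable_funPT.
Qed.

Lemma probability_past_event A j : (forall l, measurable (A l)) ->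
  P (past_event A j) = (\prod_(0 <= l < j) D (A l))%E.
Proof.
move=> mA; have [lawD indep] := xi_iid.
have -> : past_event A j =
    \bigcap_(l in [set` [fset l in iota 0 j]%fset]) (xi l @^-1` A l).
  apply/seteqP; split => [w Aw l /=|w Aw l lj].
    by rewrite in_fset_ mem_iota /= => /Aw.
  by apply: Aw => /=; rewrite in_fset_ mem_iota.
rewrite indep// /index_iota subn0.
rewrite (perm_big (iota 0 j)); last first.
  apply: uniq_perm; rewrite ?fset_uniq ?iota_uniq// => l.
  by rewrite in_fset_.
by apply: eq_bigr => l _; rewrite -(lawD l).
Qed.

(** With the [j]-th constraint replaced, a past event intersected with a
    condition on the next draw is a past event again. *)
Definition update A j C : nat -> set I := fun l => if l == j then C else A l.

Lemma measurable_update A j C l :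
  (forall l, measurable (A l)) -> measurable C -> measurable (update A j C l).
Proof. by move=> mA mC; rewrite /update; case: ifP. Qed.

Lemma past_event_update_lt A j C : past_event (update A j C) j = past_event A j.
Proof.
by apply/seteqP; split => w Aw l lj; have := Aw l lj;
  rewrite /update (ltn_eqF lj).
Qed.

Lemma past_event_update A j C :
  past_event (update A j C) j.+1 = past_event A j `&` xi j @^-1` C.
Proof. by rewrite past_eventS past_event_update_lt /update eqxx. Qed.

Lemma probability_past_event_update A j C :
  (forall l, measurable (A l)) -> measurable C ->
  P (past_event (update A j C) j.+1) = (P (past_event A j) * D C)%E.
Proof.
move=> mA mC; have mA' l := measurable_update j l mA mC.
rewrite -[X in (P X * _)%E](past_event_update_lt A j C).
rewrite !probability_past_event// big_nat_recr//=.
by rewrite [update A j C j]/update eqxx.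
Qed.

End past_events.

(** * Expectations along a random iteration *)

(** The recursion peels off the first map rather than the last: the randomness
    of that draw can then be frozen while the later maps still act on a
    deterministic point. *)
Fixpoint iterate (I E : Type) (Phi : I -> E -> E) (i : nat -> I) (m : nat)
    (y : E) : E :=
  if m is m'.+1 then iterate Phi (i \o S) m' (Phi (i 0) y) else y.

Section contraction.
Context d (T : measurableType d) d' (I : measurableType d') (R : realType)
  (P : probability T R) (D : probability I R) (xi : nat -> {RV P >-> I}).
Hypothesis xi_iid : iid D xi.
Context (E : normedModType R) (Phi : I -> E -> E) (V : E -> R).
Implicit Types (A : nat -> set I).

Hypothesis Phi_cont : forall i, continuous (Phi i).
Hypothesis V_cont : continuous V.
Hypothesis V_ge0 : forall y, 0 <= V y.
Hypothesis Phi_approx : forall y, exists s : nat -> I -> E,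
  strong_limit s (Phi^~ y) /\
  (\int[D]_i (V (s n i))%:E @[n --> \oo] --> \int[D]_i (V (Phi i y))%:E)%E.
Variables (q c : R).
Hypotheses (q_ge0 : 0 <= q) (q_le1 : q <= 1) (c_ge0 : 0 <= c).
Hypothesis V_contracted : forall y,
  (\int[D]_i (V (Phi i y))%:E <= (q * V y + (1 - q) * c)%:E)%E.

Lemma continuous_iterate i m : continuous (iterate Phi i m).
Proof.
elim: m i => [|m IH] i y; first exact: cvg_id.
apply: (@continuous_comp _ _ _ (Phi (i 0)) (iterate Phi (i \o S) m));
  [exact: Phi_cont|exact: IH].
Qed.

(* Indexed by the rank [j] of the first draw, so that the draws which the
   iterates use are those that a past event before [j] leaves free. *)
Let Z j m y w : R := V (iterate Phi (fun l => xi (j + l) w) m y).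

Let ZS j m y w : Z j m.+1 y w = Z j.+1 m (Phi (xi j w) y) w.
Proof.
rewrite /Z /= addn0; congr (V (iterate _ _ _ _)).
by apply/funext => l /=; rewrite addSnnS.
Qed.

Let cvgZ j m (u : nat -> E) y w : u n @[n --> \oo] --> y ->
  Z j m (u n) w @[n --> \oo] --> Z j m y w.
Proof.
move=> uy; apply: continuous_cvg; first exact: V_cont.
by apply: continuous_cvg => //; exact: continuous_iterate.
Qed.

Let simple_xi j s : is_simple s -> is_simple ((s : I -> E) \o xi j).
Proof. by apply: is_simple_comp; exact: measurable_funPT. Qed.

Let Z_ge0 j m y w : (0 <= (Z j m y w)%:E)%E.
Proof. by rewrite lee_fin; exact: V_ge0. Qed.

Let measurable_Z j m y : measurable_fun setT (Z j m y).
Proof.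
elim: m j y => [|m IH] j y; first exact: (@measurable_cst _ _ _ _ _ (V y)).
have [s [[ss sPhi] _]] := Phi_approx y.
apply: (@measurable_fun_cvg _ _ _ _ (fun n w => Z j.+1 m (s n (xi j w)) w)).
  move=> n; apply/measurable_EFinP.
  apply: (@measurable_simple_arg _ _ _ _ _ (fun y w => (Z j.+1 m y w)%:E)
    (simple_xi j (ss n))) => y'.
  exact/measurable_EFinP.
by move=> w _; rewrite ZS; apply: cvgZ.
Qed.

(* The affine recursion [v -> q * v + (1 - q) * c], iterated [m] times. *)
Let bound m y := q ^+ m * V y + (1 - q ^+ m) * c.

Let bound_ge0 m y : 0 <= bound m y.
Proof.
by rewrite addr_ge0// mulr_ge0// ?exprn_ge0// subr_ge0 exprn_ile1.
Qed.

Let integral_bound (s : I -> E) m : is_simple s ->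
  (\int[D]_i (bound m (s i))%:E =
   (q ^+ m)%:E * \int[D]_i (V (s i))%:E + ((1 - q ^+ m) * c)%:E)%E.
Proof.
move=> ss.
have mV : measurable_fun setT (V \o s) by exact: measurable_fun_simple.
under eq_integral do rewrite EFinD EFinM.
rewrite ge0_integralD//.
- rewrite ge0_integralZl//.
  + rewrite integral_cst//; congr (_ + _)%E.
    by rewrite -[RHS]mule1; congr (_ * _)%E; exact: probability_setT.
  + exact/measurable_EFinP.
  + by move=> i _; rewrite lee_fin.
  + by rewrite lee_fin exprn_ge0.
- by move=> i _; rewrite -EFinM lee_fin mulr_ge0// exprn_ge0.
- by apply: measurable_funeM; exact/measurable_EFinP.
- by move=> i _; rewrite lee_fin mulr_ge0// subr_ge0 exprn_ile1.
Qed.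

(* Level by level, the first point [s (xi j w)] is a constant and its level
   set is absorbed into the past event. *)
Let integral_past_simple A j m s : (forall l, measurable (A l)) ->
  is_simple s ->
  (forall A' y, (forall l, measurable (A' l)) ->
    (\int[P]_(w in past_event xi A' j.+1) (Z j.+1 m y w)%:E
     <= P (past_event xi A' j.+1) * (bound m y)%:E)%E) ->
  (\int[P]_(w in past_event xi A j) (Z j.+1 m (s (xi j w)) w)%:E
   <= P (past_event xi A j) * \int[D]_i (bound m (s i))%:E)%E.
Proof.
move=> mA ss IH; have mB := measurable_past_event xi j mA.
have [fs ms] := ss.
rewrite (@integral_simple_arg _ _ _ _ _ _ (fun y w => (Z j.+1 m y w)%:E) _
  (simple_xi j ss))//; last by move=> y; exact/measurable_EFinP.
rewrite (@integral_simple_arg _ _ _ _ _ _ (fun y _ => (bound m y)%:E) setT)//;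
  last by move=> y _; rewrite lee_fin.

rewrite ge0_mule_fsumr; last first.
  by move=> y; apply: integral_ge0 => w _; rewrite lee_fin; exact: bound_ge0.
rewrite (@fsbig_widen _ _ _ _ (range (s \o xi j)) (range s)); last 2 first.
- by move=> _ [w _ <-]; exists (xi j w).
- move=> y [_ ynr] /=; rewrite (_ : _ @^-1` _ = set0) ?setI0 ?integral_set0//.
  by apply/seteqP; split => // w /= sy; apply: ynr; exists w.
apply: lee_fsum => // y _.
have mC := ms y.
rewrite -[_ @^-1` _]/(xi j @^-1` (s @^-1` [set y])) -past_event_update.
apply: le_trans (IH _ _ _) _; first by move=> l; exact: measurable_update.
rewrite (probability_past_event_update xi_iid)// setTI integral_cst//.
by rewrite -muleA [(D _ * _)%E]muleC.
Qed.

Let limn_einf_le (u v : (\bar R)^nat) l : (forall n, u n <= v n)%E ->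
  v n @[n --> \oo] --> l -> (limn_einf u <= l)%E.
Proof.
move=> uv vl; rewrite limn_einf_lim -(cvg_lim _ vl)//.
apply: lee_lim; [exact: is_cvg_einfs|exact/cvgP/vl|apply: nearW => n].
by apply: le_trans (uv n); apply: ereal_inf_lbound; exists n => /=.
Qed.

(** Induction on the number of remaining steps, for all past events at once.
    The point [Phi (xi j w) y] reached by the first step is a limit of simple
    functions of [xi j w]; the bound holds for these by [integral_past_simple]
    and passes to the limit by Fatou's lemma, since the later steps are
    continuous in the starting point. Only the upper bound survives the limit,
    and it suffices. *)
Lemma integral_iterate_le A j m y : (forall l, measurable (A l)) ->
  (\int[P]_(w in past_event xi A j) (Z j m y w)%:E
   <= P (past_event xi A j) * (bound m y)%:E)%E.
Proof.
elim: m j A y => [|m IH] j A y mA; have mB := measurable_past_event xi j mA.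
  rewrite /Z /bound /= integral_cst// expr0 mul1r subrr mul0r addr0.
  by rewrite muleC.
have [s [[ss sPhi] sV]] := Phi_approx y.
pose f n w := (Z j.+1 m (s n (xi j w)) w)%:E.
have mf n : measurable_fun setT (f n).
  apply: (@measurable_simple_arg _ _ _ _ _ (fun y w => (Z j.+1 m y w)%:E)
    (simple_xi j (ss n))) => y'.
  exact/measurable_EFinP.
have := @fatou _ _ _ P _ mB f (fun n => measurable_funTS (mf n))
  (fun n w _ => Z_ge0 _ _ _ _).
under eq_integral => w _.
  rewrite (_ : limn_einf _ = (Z j m.+1 y w)%:E); last first.
    apply: (cvg_limn_einf_sup _).1; rewrite ZS.
    by apply: cvg_EFin; [exact: nearW|apply: cvgZ].
over.
move=> /le_trans; apply.
pose l := ((q ^+ m)%:E * \int[D]_i (V (Phi i y))%:E + ((1 - q ^+ m) * c)%:E)%E.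
apply: (@le_trans _ _ (P (past_event xi A j) * l)%E).
  apply: (limn_einf_le (fun n => integral_past_simple mA (ss n) (IH j.+1))).
  apply: cvgeZl; first exact: fin_num_measure.
  under eq_fun do rewrite integral_bound//.
  apply: cvgeD; first exact: fin_num_adde_defl.
    by apply: cvgeZl.
  exact: cvg_cst.
apply: lee_wpmul2l => //.
have : (l <= (q ^+ m)%:E * (q * V y + (1 - q) * c)%:E
              + ((1 - q ^+ m) * c)%:E)%E.
  by rewrite leeD2r// lee_wpmul2l ?V_contracted// lee_fin exprn_ge0.
move=> /le_trans; apply.
rewrite -EFinM -EFinD lee_fin /bound exprS.
by rewrite le_eqVlt; apply/orP; left; apply/eqP; ring.
Qed.

Lemma expectation_iterate_le m y :
  ('E_P[fun w => V (iterate Phi (xi^~ w) m y)]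
   <= (q ^+ m * V y + (1 - q ^+ m) * c)%:E)%E.
Proof.
have := @integral_iterate_le (fun=> setT) 0 m y (fun=> measurableT).
rewrite (_ : past_event _ _ _ = setT); last by apply/seteqP; split.
by rewrite probability_setT mul1e unlock.
Qed.

End contraction.

(** * Expectations of real functions and of inner products *)

Section means.
Context d (T : measurableType d) (R : realType) (P : probability T R).
Implicit Types (X Y : T -> R) (a r : R).

(** Replacing [g] by the maximum of [f] and [g] changes it on a null set only,
    and makes the inequality hold everywhere. *)
Lemma ae_le_integral (f g : T -> \bar R) :
  P.-integrable setT f -> P.-integrable setT g ->
  (\forall w \ae P, f w <= g w)%E ->
  (\int[P]_w f w <= \int[P]_w g w)%E.
Proof.
move=> intf intg fg.
have mf := measurable_int _ intf; have mg := measurable_int _ intg.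
have mM : measurable_fun setT (fun w => maxe (f w) (g w)).
  exact: measurable_maxe.
have gM : ae_eq P setT g (fun w => maxe (f w) (g w)).
  by apply: filterS fg => w fgw _; rewrite (max_idPr fgw).
rewrite (ae_eq_integral _ _ _ _ _ gM)//; apply: le_integral => //.
  apply/integrableP; split => //.
  move/integrableP : intg => [_]; apply: le_lt_trans.
  rewrite (ae_eq_integral (fun w => `|g w|)%E)//.
  - exact: measurableT_comp.
  - exact: measurableT_comp.
  - by apply: filterS gM => w gMw _; rewrite -gMw.
by move=> w _; rewrite le_max lexx.
Qed.

Definition has_mean X r : Prop :=
  P.-integrable setT (EFin \o X) /\ (\int[P]_w (X w)%:E = r%:E)%E.

Lemma has_mean_cst a : has_mean (cst a) a.
Proof.
split; first exact: finite_measure_integrable_cst.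
rewrite [LHS](integral_cst P measurableT a%:E) -[RHS]mule1.
by congr (_ * _)%E; exact: probability_setT.
Qed.

Lemma has_meanD X Y r r' : has_mean X r -> has_mean Y r' ->
  has_mean (fun w => X w + Y w) (r + r').
Proof.
move=> [iX eX] [iY eY]; split; first exact: (integrableD _ iX iY).
by under eq_integral do rewrite EFinD; rewrite integralD// eX eY.
Qed.

Lemma has_meanZl X r a : has_mean X r -> has_mean (fun w => a * X w) (a * r).
Proof.
move=> [iX eX]; split; first exact: (integrableZl _ _ iX).
by under eq_integral do rewrite EFinM; rewrite integralZl// eX.
Qed.

Lemma has_mean_sum (J : Type) (s : seq J) (X : J -> T -> R) (r : J -> R) :
  (forall j, has_mean (X j) (r j)) ->
  has_mean (fun w => \sum_(j <- s) X j w) (\sum_(j <- s) r j).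
Proof.
move=> Xr; elim: s => [|j s IH].
  by under eq_fun do rewrite big_nil; rewrite big_nil; exact: has_mean_cst.
by under eq_fun do rewrite big_cons; rewrite big_cons; exact: has_meanD.
Qed.

Lemma has_mean_indic (A : set T) : measurable A -> has_mean \1_A (fine (P A)).
Proof.
move=> mA; split; first exact: integrable_indic.
by rewrite integral_indic// setIT fineK// fin_num_measure.
Qed.

Lemma integral_le_mean X Y r :
  P.-integrable setT (EFin \o X) -> has_mean Y r ->
  (\forall w \ae P, X w <= Y w) -> (\int[P]_w (X w)%:E <= r%:E)%E.
Proof.
by move=> iX [iY <-] XY; exact: ae_le_integral.
Qed.

Lemma le_has_mean X Y r r' : has_mean X r -> has_mean Y r' ->
  (\forall w \ae P, X w <= Y w) -> r <= r'.
Proof.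
by move=> [iX eX] mY XY; have := integral_le_mean iX mY XY; rewrite eX lee_fin.
Qed.

Lemma le_integrable_affine X Y a b : measurable_fun setT X ->
  (forall w, 0 <= X w) -> P.-integrable setT (EFin \o Y) ->
  (forall w, X w <= a + b * Y w) -> P.-integrable setT (EFin \o X).
Proof.
move=> mX X0 iY XY.
have iaY : P.-integrable setT (fun w => (a%:E + b%:E * (Y w)%:E)%E).
  apply: (@integrableD _ _ _ _ _ _ (fun=> a%:E)) => //.
    exact: finite_measure_integrable_cst.
  exact: integrableZl.
apply: le_integrable iaY => //; first exact/measurable_EFinP.
move=> w _; rewrite /= lee_fin ger0_norm// (le_trans (XY w))//.
exact: ler_norm.
Qed.

Context (H : normedModType R) (ip : {dot H for idfun}).
Hypothesis Hilbert : norm_induced_by ip.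

Lemma continuous_ip v : continuous (ip v : H -> R).
Proof.
move=> x; apply/cvgrPdist_le => /= e e0.
have e'0 : 0 < e / (`|v| + 1) by rewrite divr_gt0// ltr_wpDl.
have : \forall y \near x, `|x - y| <= e / (`|v| + 1).
  by apply: cvgr_dist_le => //; exact: cvg_id.
apply: filterS => y xy.
rewrite -(ipNr ip) -(ipDr ip).
apply: le_trans (cauchy_schwarz Hilbert _ _) _.
move: xy; rewrite ler_pdivlMr ?ltr_wpDl// => /(le_trans _); apply.
by rewrite mulrC ler_wpM2l// lerDl.
Qed.

Lemma has_mean_ip_simple v (s : T -> H) : is_simple s ->
  has_mean (fun w => ip v (s w)) (ip v (simple_expectation P s)).
Proof.
move=> [fs ms].
have -> : (fun w => ip v (s w)) = (fun w =>
    \sum_(y <- fset_set (range s)) ip v y * \1_(s @^-1` [set y]) w).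
  apply/funext => w; rewrite -fsbig_finite//.
  rewrite -(@fsbig_widen _ _ _ _ [set s w]) ?fsbig_set1.
  - by rewrite indicE mem_set//= mulr1.
  - by move=> _ ->.
  - by move=> y [_ /= ys]; rewrite indicE memNset/= ?mulr0// => /esym.
rewrite /simple_expectation fsbig_finite//.
have -> :
    ip v (\sum_(y <- fset_set (range s)) fine (P (s @^-1` [set y])) *: y) =
    \sum_(y <- fset_set (range s)) ip v y * fine (P (s @^-1` [set y])).
  rewrite linear_sum; apply: eq_bigr => y _.
  exact: etrans (ipZr ip _ v y) (mulrC _ _).
by apply: has_mean_sum => y; apply/has_meanZl/has_mean_indic.
Qed.

(** A continuous linear functional commutes with the Bochner integral: it does
    so on simple functions, and [cauchy_schwarz] turns the convergence in mean
    of the approximants into convergence of their images. *)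
Lemma has_mean_ip v (X : T -> H) m : has_expectation P X m ->
  has_mean (fun w => ip v (X w)) (ip v m).
Proof.
move=> [s [ss sX sL1 sm]].
have mX u : measurable_fun setT (fun w => `|X w - u|).
  apply: (@measurable_strong_limit _ _ _ _ s X (fun x => `|x - u|)) => // x.
  by apply: cvg_norm; apply: cvgB; [exact: cvg_id|exact: cvg_cst].
have mXs n : measurable_fun setT (fun w => `|X w - s n w|%:E).
  apply: (@measurable_simple_arg _ _ _ _ _ (fun y w => `|X w - y|%:E) (ss n)).
  by move=> y; exact/measurable_EFinP.
have mipX : measurable_fun setT (fun w => ip v (X w)).
  by apply: (@measurable_strong_limit _ _ _ _ s X (ip v));
    first exact: continuous_ip.
have iX : P.-integrable setT (EFin \o (fun w => ip v (X w))).
  have [n sn] : exists n, (\int[P]_w `|X w - s n w|%:E)%E \is a fin_num.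
    by have /fine_cvgP[[n _ +] _] := sL1; move=> /(_ n (leqnn n)); exists n.
  have iXs : P.-integrable setT (fun w => `|X w - s n w|%:E).
    apply/integrableP; split => //.
    under eq_integral do rewrite gee0_abs//.
    by rewrite -ge0_fin_numE// integral_ge0.
  have [isn _] := has_mean_ip_simple v (ss n).
  have := integrableD measurableT (integrableZl measurableT (`|v|) iXs)
    (integrable_abse isn).
  apply: le_integrable => //; first exact/measurable_EFinP.
  move=> w _ /=; rewrite lee_fin [leRHS]ger0_norm ?addr_ge0 ?mulr_ge0//.
  apply: le_trans (lerD (cauchy_schwarz Hilbert v (X w - s n w)) (lexx _)).
  rewrite (ipDr ip) (ipNr ip).
  by rewrite -[X in `|X| <= _](subrK (ip v (s n w))) ler_normD.
have [e eX] : exists e, (\int[P]_w (ip v (X w))%:E)%E = e%:E.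
  exists (fine (\int[P]_w (ip v (X w))%:E)).
  by rewrite fineK// integrable_fin_num.
split => //; rewrite eX; congr EFin; apply/eqP.
rewrite -subr_eq0 -normr_eq0 eq_le normr_ge0 andbT -lee_fin.
pose E_ n := simple_expectation P (s n).
apply: (@lee_cvg_to _ \oo _ _ (fun n => `|e - ip v (E_ n)|%:E)
  (fun n => `|v|%:E * \int[P]_w `|X w - s n w|%:E)%E).
- apply: cvg_EFin; first exact: nearW.
  apply: cvg_norm; apply: cvgB; first exact: cvg_cst.
  by apply: continuous_cvg => //; exact: continuous_ip.
- have fv : `|v|%:E \is a fin_num by [].
  by have := cvgeZl fv sL1; rewrite mule0.
apply: nearW => n.
rewrite (_ : e - _ = e + -1 * ip v (E_ n)); last by rewrite mulN1r.
have [iD eD] := has_meanD (conj iX eX)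
  (has_meanZl (-1) (has_mean_ip_simple v (ss n))).
rewrite -abse_EFin -eD.
apply: le_trans (le_abse_integral _ _ _) _ => //.
  exact: measurable_int iD.
rewrite -ge0_integralZl//.
apply: ge0_le_integral => //.
- by apply: measurableT_comp => //; exact: measurable_int iD.
- exact: measurable_funeM.
move=> w _ /=; rewrite -EFinM lee_fin mulN1r -(ipNr ip) -(ipDr ip).
exact: cauchy_schwarz.
Qed.

End means.

(** * One step of stochastic gradient descent *)

Section square_integrable.
Context d (T : measurableType d) (R : realType) (P : probability T R)
  (H : normedModType R).

Lemma sqr_normD_le (x y : H) : `|x + y| ^+ 2 <= 2 * `|x| ^+ 2 + 2 * `|y| ^+ 2.
Proof.
have : `|x + y| ^+ 2 <= (`|x| + `|y|) ^+ 2.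
  by rewrite ler_sqr ?nnegrE ?addr_ge0// ler_normD.
have := sqr_ge0 (`|x| - `|y|); nra.
Qed.

Lemma continuous_sqr_dist (x : H) : continuous (fun y => `|y - x| ^+ 2 : R).
Proof.
move=> y; apply: (@cvg_comp _ _ _ (fun y : H => `|y - x|)
  (fun r : R => r ^+ 2)).
  by apply: cvg_norm; apply: cvgB; [exact: cvg_id|exact: cvg_cst].
exact: exprn_continuous.
Qed.

(** The approximants of [strong_limit_dominated] are dominated by a square
    integrable function, so dominated convergence applies to the squares. *)
Lemma square_mean_approx (s : nat -> T -> H) (X : T -> H) (x : H) :
  strong_limit s X -> P.-integrable setT (fun w => (`|X w| ^+ 2)%:E) ->
  exists s' : nat -> T -> H, strong_limit s' X /\
    (\int[P]_w (`|s' n w - x| ^+ 2)%:E @[n --> \oo] -->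
     \int[P]_w (`|X w - x| ^+ 2)%:E)%E.
Proof.
move=> sX iX; have [s' [s'X s'le]] := strong_limit_dominated sX.
exists s'; split => //.
(* [2 * (r + 1) ^+ 2 <= 4 + 4 * r ^+ 2]. *)
pose g w := (4 + 2 * `|x| ^+ 2) + 4 * `|X w| ^+ 2.
have ig : P.-integrable setT (EFin \o g).
  apply: (@integrableD _ _ _ _ _ _ (fun=> (4 + 2 * `|x| ^+ 2)%:E)
    (fun w => (4%:E * (`|X w| ^+ 2)%:E)%E)) => //.
    exact: finite_measure_integrable_cst.
  exact: integrableZl.
have [] := @dominated_convergence _ _ _ P _ measurableT
  (fun n w => (`|s' n w - x| ^+ 2)%:E) (fun w => (`|X w - x| ^+ 2)%:E)
  (EFin \o g) _ _ _ ig _ => //.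
- move=> n; apply/measurable_EFinP.
  apply: (measurable_fun_simple (fun y => `|y - x| ^+ 2)).
  by case: s'X.
- apply/measurable_EFinP.
  apply: (@measurable_strong_limit _ _ _ _ s' X (fun y => `|y - x| ^+ 2) _ s'X).
  exact: continuous_sqr_dist.
- apply: aeW => w _; apply: cvg_EFin; first exact: nearW.
  apply: (@continuous_cvg _ _ _ _ _ _ (fun y : H => `|y - x| ^+ 2)).
    exact: continuous_sqr_dist.
  by case: s'X.
- apply: aeW => w n _ /=; rewrite lee_fin ger0_norm ?sqr_ge0//.
  apply: le_trans (sqr_normD_le _ _) _; rewrite normrN /g.
  have : `|s' n w| ^+ 2 <= (`|X w| + 1) ^+ 2.
    by rewrite ler_sqr ?nnegrE ?addr_ge0.
  have := sqr_ge0 (`|X w| - 1); nra.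
Qed.

End square_integrable.

Section sgd_step.
Context (R : realType) (H : normedModType R) (ip : {dot H for idfun}).
Hypothesis Hilbert : norm_induced_by ip.
Context dI (I : measurableType dI) (D : probability I R).
Context (f : I -> H -> R) (gradf : I -> H -> H) (gradF : H -> H).
Variables (L mu sigma2 gamma : R) (xstar : H).
Hypothesis f_convex : forall i, convex_function [set: H] (f i).
Hypothesis f_grad : forall i x, is_gradient ip (f i) x (gradf i x).
Hypothesis f_smooth : \forall i \ae D,
  forall x y, `|gradf i x - gradf i y| <= L * `|x - y|.
Hypothesis unbiased : forall x, has_expectation D (gradf^~ x) (gradF x).
Hypothesis F_sconvex : strongly_convex ip mu gradF.
Hypothesis gradF0 : gradF xstar = 0.
Hypothesis sigma2E : has_mean D (fun i => `|gradf i xstar| ^+ 2) sigma2.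

Let strong_limit_gradf y : exists s, strong_limit s (gradf^~ y).
Proof. by have [s [ss sl _ _]] := unbiased y; exists s. Qed.

(** Averaging the Lipschitz bounds makes [gradF] itself [L]-Lipschitz, while
    strong convexity makes it expand by [mu] along [y - xstar]. *)
Lemma strong_convexity_le_smoothness y : y != xstar -> mu <= L.
Proof.
move=> yx; have n0 : 0 < `|y - xstar| ^+ 2.
  by rewrite exprn_gt0// normr_gt0 subr_eq0.
rewrite -(ler_pM2r n0); apply: le_trans (F_sconvex y xstar) _.
have m := has_meanD (has_mean_ip Hilbert (y - xstar) (unbiased y))
  (has_meanZl (-1) (has_mean_ip Hilbert (y - xstar) (unbiased xstar))).
rewrite (ipDr ip) (ipNr ip) -mulN1r.
apply: (le_has_mean m (has_mean_cst D (L * `|y - xstar| ^+ 2))).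
apply: filterS f_smooth => i Li /=.
rewrite mulN1r -(ipNr ip) -(ipDr ip).
apply: le_trans (ler_norm _) _; apply: le_trans (cauchy_schwarz Hilbert _ _) _.
by rewrite expr2 mulrCA ler_wpM2l.
Qed.

(** By smoothness [gradf i y] stays at a bounded distance from
    [gradf i xstar], which is square integrable. *)
Lemma integrable_sqr_gradf y :
  D.-integrable setT (fun i => (`|gradf i y| ^+ 2)%:E).
Proof.
have [s sl] := strong_limit_gradf y.
have mg : measurable_fun setT (fun i => `|gradf i y| ^+ 2).
  have := measurable_strong_limit (@continuous_sqr_dist _ H 0) sl.
  by congr (measurable_fun _ _); apply/funext => i /=; rewrite subr0.
have [is2 es2] := has_meanD (has_mean_cst D (2 * L ^+ 2 * `|y - xstar| ^+ 2))
  (has_meanZl 2 sigma2E).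
apply/integrableP; split; first exact/measurable_EFinP.
move/integrableP : (is2) => [_]; apply: le_lt_trans.
apply: ae_ge0_le_integral => //.
- by do 2! apply: measurableT_comp => //; exact/measurable_EFinP.
- by apply: measurableT_comp => //; exact: measurable_int is2.
apply: filterS f_smooth => i Li _ /=; rewrite lee_fin ger0_norm ?sqr_ge0//.
apply: le_trans (ler_norm _); rewrite /cst.
have -> : gradf i y = gradf i y - gradf i xstar + gradf i xstar.
  by rewrite subrK.
apply: le_trans (sqr_normD_le _ _) _; rewrite lerD2r -mulrA ler_pM2l// -exprMn.
by rewrite ler_sqr ?nnegrE ?Li ?(le_trans (normr_ge0 _) (Li _ _)).
Qed.

Lemma strong_limit_step y : exists s : nat -> I -> H,
  strong_limit s (fun i => y - gamma *: gradf i y).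
Proof.
have [s [ss sl]] := strong_limit_gradf y.
exists (fun n i => y - gamma *: s n i); split=> [n|i].
  exact: (is_simple_map (fun x => y - gamma *: x) (ss n)).
by apply: cvgB; [exact: cvg_cst|exact: cvgZr].
Qed.

Lemma measurable_sqr_step y x :
  measurable_fun setT (fun i => `|y - gamma *: gradf i y - x| ^+ 2).
Proof.
have [s sl] := strong_limit_step y.
apply: (@measurable_strong_limit _ _ _ _ s _ (fun z => `|z - x| ^+ 2) _ sl).
exact: continuous_sqr_dist.
Qed.

Lemma integrable_sqr_step y x :
  D.-integrable setT (fun i => (`|y - gamma *: gradf i y - x| ^+ 2)%:E).
Proof.
apply: (@le_integrable_affine _ _ _ _ _ (fun i => `|gradf i y| ^+ 2)
  (2 * `|y - x| ^+ 2) (2 * gamma ^+ 2)).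
- exact: measurable_sqr_step.
- by move=> i; exact: sqr_ge0.
- exact: integrable_sqr_gradf.
move=> i; rewrite addrAC; apply: le_trans (sqr_normD_le _ _) _.
by rewrite normrN normrZ exprMn real_normK ?num_real// -mulrA.
Qed.

Lemma sgd_step_approx y : exists s : nat -> I -> H,
  strong_limit s (fun i => y - gamma *: gradf i y) /\
  (\int[D]_i (`|s n i - xstar| ^+ 2)%:E @[n --> \oo] -->
   \int[D]_i (`|y - gamma *: gradf i y - xstar| ^+ 2)%:E)%E.
Proof.
have [s sl] := strong_limit_step y.
apply: (square_mean_approx xstar sl).
have := integrable_sqr_step y 0.
by apply: eq_integrable => // i _; rewrite subr0.
Qed.

(** The core estimate. Expanding the square leaves [gamma ^+ 2] times the
    second moment of [gradf i y]; splitting off [gradf i xstar] and applying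
    [cocoercive] to the rest for each [i] bounds it by [2 * L] times the same
    inner product that drives the descent, plus [2 * sigma2]. Averaging over
    [i] and strong convexity finish. Applying co-coercivity before averaging is
    what gives [L / mu] and not its square. *)
Lemma sgd_step_le y : 0 < L -> 0 <= gamma -> gamma * L <= 1 ->
  (\int[D]_i (`|y - gamma *: gradf i y - xstar| ^+ 2)%:E <=
   ((1 - 2 * gamma * mu * (1 - gamma * L)) * `|y - xstar| ^+ 2
    + 2 * gamma ^+ 2 * sigma2)%:E)%E.
Proof.
move=> L0 gamma0 gammaL; set e := y - xstar.
(* The majorant that co-coercivity gives for each index, built together with
   its mean. *)
have mZ := has_meanD (has_mean_cst D (`|e| ^+ 2))
  (has_meanD
    (has_meanZl (- (2 * gamma * (1 - gamma * L)))
      (has_mean_ip Hilbert e (unbiased y)))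
    (has_meanD
      (has_meanZl (- (2 * gamma ^+ 2 * L))
        (has_mean_ip Hilbert e (unbiased xstar)))
      (has_meanZl (2 * gamma ^+ 2) sigma2E))).
apply: le_trans (integral_le_mean (integrable_sqr_step y xstar) mZ _) _.
  apply: filterS f_smooth => i Li /=.
  rewrite addrAC -/e (sqr_normB Hilbert) (ipZr ip) normrZ exprMn.
  rewrite real_normK ?num_real//.
  have := cocoercive Hilbert y xstar L0 (f_convex i) (f_grad i) Li.
  rewrite -/e (ipDr ip) (ipNr ip) => coc.
  have := sqr_normD_le (gradf i y - gradf i xstar) (gradf i xstar).
  rewrite subrK; have := sqr_ge0 gamma.
  set a := `|gradf i y| ^+ 2.
  set b := `|gradf i y - gradf i xstar| ^+ 2 in coc *.
  set c := `|gradf i xstar| ^+ 2; set A := ip e _ in coc *.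
  set B := ip e _ in coc *.
  move=> g2 habc.
  have h1 : gamma ^+ 2 * a <= gamma ^+ 2 * (2 * (L * (A - B)) + 2 * c).
    by apply: ler_wpM2l => //; lra.
  lra.
rewrite lee_fin gradF0.
have -> : ip e 0 = 0 by rewrite -(subrr e) (ipDr ip) (ipNr ip) subrr.
have := F_sconvex y xstar; rewrite gradF0 subr0 -/e => sc.
have k0 : 0 <= 2 * gamma * (1 - gamma * L).
  by rewrite mulr_ge0 ?mulr_ge0// subr_ge0.
have := ler_wpM2l k0 sc; lra.
Qed.

End sgd_step.

(** * The choice of the step size *)

Section step_size.
Context (R : realType) (L mu sigma2 eps : R).
Hypotheses (mu_gt0 : 0 < mu) (mu_leL : mu <= L) (sigma2_ge0 : 0 <= sigma2)
  (eps_gt0 : 0 < eps).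

Let gamma := mu * eps / (2 * eps * mu * L + 2 * sigma2).
Let q := 1 - 2 * gamma * mu * (1 - gamma * L).

Let L_gt0 : 0 < L. Proof. exact: lt_le_trans mu_leL. Qed.

Let den_gt0 : 0 < 2 * eps * mu * L + 2 * sigma2.
Proof. by rewrite ltr_wpDr ?mulr_ge0// !mulr_gt0. Qed.

Lemma step_size_gt0 : 0 < gamma.
Proof. by rewrite divr_gt0// mulr_gt0. Qed.

(** The defining equation of [gamma], solved for the noise term. *)
Lemma step_sizeE : 2 * gamma * sigma2 = mu * eps * (1 - 2 * (gamma * L)).
Proof.
have : gamma * (2 * eps * mu * L + 2 * sigma2) = mu * eps.
  by rewrite divfK// gt_eqF.
lra.
Qed.

Lemma step_sizeL_le : gamma * L <= 1 / 2.
Proof.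
have me : 0 < mu * eps by rewrite mulr_gt0.
have g0 := ltW step_size_gt0.
have : 0 <= mu * eps * (1 - 2 * (gamma * L)).
  by rewrite -step_sizeE mulr_ge0// mulr_ge0.
by rewrite pmulr_rge0//; lra.
Qed.

(** Because [mu <= L], [q] is at least [1 - 2 * t * (1 - t)] with
    [t := gamma * L]. *)
Lemma contraction_rate_ge0 : 0 <= q.
Proof.
have g0 := step_size_gt0; have gL := step_sizeL_le.
have gmu : gamma * mu <= gamma * L by rewrite ler_pM2l.
have h : gamma * mu * (1 - gamma * L) <= gamma * L * (1 - gamma * L).
  by apply: ler_wpM2r => //; lra.
have := sqr_ge0 (1 - 2 * (gamma * L)); rewrite /q; nra.
Qed.

Lemma contraction_rate_le : q <= 1 - gamma * mu.
Proof.
have gL := step_sizeL_le.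
have gm : 0 <= gamma * mu by rewrite ltW// mulr_gt0//; exact: step_size_gt0.
rewrite /q; nra.
Qed.

(** [eps / 2] lies above the fixed point of the one-step recursion: this is
    what the step size is chosen for. *)
Lemma contraction_noise_le : 2 * gamma ^+ 2 * sigma2 <= (1 - q) * (eps / 2).
Proof.
have -> : 2 * gamma ^+ 2 * sigma2 = gamma * (2 * gamma * sigma2) by ring.
rewrite step_sizeE /q.
have g0 := ltW step_size_gt0.
have : 0 <= gamma * mu * eps * (gamma * L).
  have [[m0 e0] l0] := (ltW mu_gt0, ltW eps_gt0, ltW L_gt0).
  by apply: mulr_ge0; apply: mulr_ge0 => //; apply: mulr_ge0.
lra.
Qed.

(** The factor of the logarithm in the iteration count is exactly
    [(gamma * mu)^-1], and [q <= 1 - gamma * mu <= expR (- (gamma * mu))]. A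
    negative logarithm needs no separate treatment, as [0 <= q]. *)
Lemma contraction_rate_exp_le (e0 : R) (k : nat) : 0 <= e0 ->
  e0 = 0 \/
    2 * ln (2 * e0 / eps) * (L / mu + sigma2 / (mu ^+ 2 * eps)) <= k%:R ->
  q ^+ k * e0 <= eps / 2.
Proof.
move=> e0_ge0 [->|hk]; first by rewrite mulr0 divr_ge0// ltW.
have [->|e0N0] := eqVneq e0 0; first by rewrite mulr0 divr_ge0// ltW.
have e0_gt0 : 0 < e0 by rewrite lt_neqAle eq_sym e0N0.
have gm : 0 < gamma * mu by rewrite mulr_gt0//; exact: step_size_gt0.
have hgm : 2 * (L / mu + sigma2 / (mu ^+ 2 * eps)) * (gamma * mu) = 1.
  rewrite /gamma; field.
  by rewrite !gt_eqF.
have lnk : ln (2 * e0 / eps) <= k%:R * (gamma * mu).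
  move: hk; rewrite -(ler_pM2r gm); apply: le_trans.
  rewrite le_eqVlt; apply/orP; left; apply/eqP.
  move: hgm; set S := L / mu + _ => hgm.
  transitivity (ln (2 * e0 / eps) * (2 * S * (gamma * mu))).
    by rewrite hgm mulr1.
  by rewrite mulrA [X in X * _]mulrA [ln _ * 2]mulrC.
have a_gt0 : 0 < 2 * e0 / eps by rewrite divr_gt0// mulr_gt0.
have qk : q ^+ k <= expR (- ln (2 * e0 / eps)).
  apply: (@le_trans _ _ (expR (- (gamma * mu)) ^+ k)).
    rewrite lerXn2r ?nnegrE ?contraction_rate_ge0 ?expR_ge0//.
    exact: le_trans contraction_rate_le (expR_ge1Dx _).
  by rewrite -expRM_natl ler_expR mulrN lerN2.
apply: le_trans (ler_wpM2r e0_ge0 qk) _.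
rewrite expRN lnK ?posrE// le_eqVlt; apply/orP; left; apply/eqP; field.
by rewrite !gt_eqF.
Qed.

End step_size.

Lemma sgd_iterate (R : realType) (H : lmodType R) (I : Type)
    (gradf : I -> H -> H) (gamma : R) (x : H) (i : nat -> I) (k : nat) :
  sgd gradf gamma x i k = iterate (fun j y => y - gamma *: gradf j y) i k x.
Proof.
have sgdS m : forall y j, sgd gradf gamma y j m.+1 =
    sgd gradf gamma (y - gamma *: gradf (j 0) y) (j \o S) m.
  by elim: m => [//|m IH] y j /=; rewrite -IH.
by elim: k x i => [//|k IH] x i; rewrite sgdS IH.
Qed.

Theorem corollary2p2 (R : realType)
  (H : completeNormedModType R) (ip : {dot H for idfun})
  (Hilbert : norm_induced_by ip)
  (dI : measure_display) (I : measurableType dI) (D : probability I R)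
  (f : I -> H -> R) (gradf : I -> H -> H) (L : I -> R) (supL : R)
  (F : H -> R) (gradF : H -> H) (mu : R)
  (xstar x0 : H) (sigma2 : R)
  (f_convex : forall i, convex_function [set: H] (f i))
  (f_grad : forall i x, is_gradient ip (f i) x (gradf i x))
  (gradf_cont : forall i, continuous (gradf i))
  (gradf_lip : forall i, (L i).-lipschitz (gradf i))
  (supLE : ess_sup D (EFin \o L) = supL%:E)
  (f_int : forall x, D.-integrable setT (fun i => (f i x)%:E))
  (FE : forall x, ('E_D[fun i => f i x] = (F x)%:E)%E)
  (F_grad : forall x, is_gradient ip F x (gradF x))
  (unbiased : forall x, has_expectation D (fun i => gradf i x) (gradF x))
  (mu_gt0 : 0 < mu)
  (F_sconvex : strongly_convex ip mu gradF)
  (xstar_min : forall x, F xstar <= F x)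
  (sigma2E : ('E_D[fun i => (`|gradf i xstar| ^+ 2)%R] = sigma2%:E)%E)
  (dT : measure_display) (T : measurableType dT) (P : probability T R)
  (xi : nat -> {RV P >-> I}) (xi_iid : iid D xi)
  (eps : R) (eps_gt0 : 0 < eps) :
  let eps0 := `|x0 - xstar| ^+ 2 in
  let gamma := mu * eps / (2 * eps * mu * supL + 2 * sigma2) in
  forall k : nat,
    eps0 = 0 \/
      2 * ln (2 * eps0 / eps) * (supL / mu + sigma2 / (mu ^+ 2 * eps)) <= k%:R ->
    ('E_P[fun w => (`|sgd gradf gamma x0 (fun j => xi j w) k - xstar| ^+ 2)%R]
       <= eps%:E)%E.
Proof.
move=> eps0 gamma k hk.
have smooth : \forall i \ae D,
    forall x y, `|gradf i x - gradf i y| <= supL * `|x - y|.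
  have := ess_sup_ge D (EFin \o L); rewrite supLE.
  apply: filterS => i /=; rewrite lee_fin => Li x y.
  have /= /le_trans := gradf_lip i (x, y) (conj Logic.I Logic.I); apply.
  exact: ler_wpM2r.
have gradF0 := gradient_min_eq0 Hilbert F_grad xstar_min.
have sigma2_mean : has_mean D (fun i => `|gradf i xstar| ^+ 2) sigma2.
  move: sigma2E; rewrite unlock => sigma2E'; split => //.
  have [s [ss sl _ _]] := unbiased xstar.
  apply/integrableP; split.
    apply/measurable_EFinP.
    have := @measurable_strong_limit _ _ _ _ s _ (fun x => `|x - 0| ^+ 2)
      (@continuous_sqr_dist _ H 0) (conj ss sl).
    by congr (measurable_fun _ _); apply/funext => i /=; rewrite subr0.
  under eq_integral => i _ do rewrite /= ger0_norm ?sqr_ge0//.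
  by rewrite sigma2E' ltry.
have sigma2_ge0 : 0 <= sigma2.
  by rewrite -lee_fin -(proj2 sigma2_mean) integral_ge0.
(* If [H] is reduced to a point then [supL] is unconstrained, possibly
   negative, but every iterate is [xstar]. *)
have [[z zx]|nz] := pselect (exists z, z != xstar); last first.
  have all_eq y : y = xstar by apply/eqP/negP => /negP yx; apply: nz; exists y.
  rewrite unlock (eq_integral (cst 0%E)) ?integral_cst ?mul0e ?lee_fin ?ltW//.
  by move=> w _; rewrite (all_eq (sgd _ _ _ _ _)) subrr normr0 expr0n.
have muL := strong_convexity_le_smoothness Hilbert smooth unbiased F_sconvex zx.
have L_gt0 : 0 < supL by exact: lt_le_trans muL.
have gamma_gt0 := step_size_gt0 mu_gt0 muL sigma2_ge0 eps_gt0.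
have gammaL := step_sizeL_le mu_gt0 muL sigma2_ge0 eps_gt0.
have q_ge0 := contraction_rate_ge0 mu_gt0 muL sigma2_ge0 eps_gt0.
have q_le := contraction_rate_le mu_gt0 muL sigma2_ge0 eps_gt0.
have noise := contraction_noise_le mu_gt0 muL sigma2_ge0 eps_gt0.
have rate := contraction_rate_exp_le mu_gt0 muL sigma2_ge0 eps_gt0
  (sqr_ge0 _) hk.
rewrite -/gamma in gamma_gt0 gammaL q_ge0 q_le noise rate.
set q := 1 - 2 * gamma * mu * (1 - gamma * supL) in q_ge0 q_le noise rate.
have q_le1 : q <= 1.
  by apply: le_trans q_le _; rewrite gerBl mulr_ge0// ltW.
pose Phi i y := y - gamma *: gradf i y.
pose V y := `|y - xstar| ^+ 2.
have Phi_cont i : continuous (Phi i).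
  by move=> y; apply: cvgB; [exact: cvg_id|apply: cvgZr; exact: gradf_cont].
have step y : (\int[D]_i (V (Phi i y))%:E <=
    (q * V y + (1 - q) * (eps / 2))%:E)%E.
  apply: le_trans (sgd_step_le Hilbert f_convex f_grad smooth unbiased F_sconvex
    gradF0 sigma2_mean y L_gt0 (ltW gamma_gt0) _) _; first by lra.
  by rewrite lee_fin lerD2l.
have := expectation_iterate_le xi_iid Phi_cont (@continuous_sqr_dist _ H xstar)
  (fun y => sqr_ge0 _) (sgd_step_approx gamma smooth unbiased sigma2_mean)
  q_ge0 q_le1 (divr_ge0 (ltW eps_gt0) (ler0n _ 2)) step k x0.
under [X in ('E_P[X] <= _)%E -> _]eq_fun do rewrite -sgd_iterate.
move=> /le_trans; apply; rewrite lee_fin.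
have : 0 <= q ^+ k * (eps / 2).
  by rewrite mulr_ge0 ?exprn_ge0// divr_ge0// ltW.
move: rate; rewrite /eps0; lra.
Qed.
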